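(* Let $n\ge 1$ and $0\le k\le n-1$ be integers. Then $$\begin{bmatrix} n\\ k\end{bmatrix}_{\mathcal{F}}=\sum_{i=0}^{k}\left\{ q^{F_{n-k}\sum_{j=1}^{i}F_{k-j+2}}\left(\prod_{j=1}^{i}[F_{n-k-1}]_{q^{F_{k-j+1}}}\right)[F_{k-i+1}]_{q^{F_{n-k}}}\begin{bmatrix} n-i-1\\ k-i\end{bmatrix}_{\mathcal{F}}\right\}.$$
   Context: Fibonacci numbers: $F_0=0$, $F_1=1$, $F_n=F_{n-1}+F_{n-2}$. For an integer $m\ge 0$, $[m]_q=\sum_{i=0}^{m-1}q^i$ (so $[0]_q=0$), with $q$ an indeterminate, and $[m]_{q^s}=\sum_{i=0}^{m-1}q^{si}$ for an integer $s\ge 0$. Put $[F_m]_q!=\prod_{i=1}^m [F_i]_q$ (with $[F_0]_q!=1$). The $q$-Fibonomial coefficient is, for integers $0\le k\le n$, $$\begin{bmatrix} n\\ k\end{bmatrix}_{\mathcal{F}}=\frac{[F_n]_q!}{[F_k]_q!\,[F_{n-k}]_q!}.$$ Empty sums are $0$ and empty products are $1$. *)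

(* Defs.v *)
From mathcomp Require Import all_boot all_order all_algebra.

Set Implicit Arguments.
Unset Strict Implicit.
Unset Printing Implicit Defensive.

Import GRing.Theory.
Local Open Scope ring_scope.

Fixpoint fib (n : nat) : nat :=
  match n with
  | 0 => 0
  | 1 => 1
  | (m.+1 as p).+1 => fib p + fib m
  end.

(* Frac(Z[q]) = Q(q), where the q-Fibonomial coefficients are defined as
   quotients. *)
Notation qfield := {fraction {poly int}}.

Definition q : qfield := tofrac 'X.

(* [m]_x, used with base x = q or x = q ^+ s. *)
Definition qint (x : qfield) (m : nat) : qfield := \sum_(0 <= i < m) x ^+ i.

Definition qfib_fact (m : nat) : qfield :=
  \prod_(1 <= i < m.+1) qint q (fib i).

(* Meaningful for k <= n only, since n - k is truncated. *)
Definition qfibonomial (n k : nat) : qfield :=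
  qfib_fact n / (qfib_fact k * qfib_fact (n - k)).

(* Main.v *)
(* Splitting an interval of length F_n = F_{n-k} F_{k+1} + F_{n-k-1} F_k, and
   using [a b]_q = [a]_q [b]_{q^a}, gives the Pascal-type rule
   (n, k) = [F_{k+1}]_{q^{F_{n-k}}} (n-1, k)
            + q^{F_{n-k} F_{k+1}} [F_{n-k-1}]_{q^{F_k}} (n-1, k-1).
   The second term keeps n - k fixed, so unfolding it down to k = 0 yields the
   sum. *)
Require Import Defs.
From mathcomp Require Import all_boot all_order all_algebra.
From mathcomp Require Import ring zify.

Import GRing.Theory.
Local Open Scope ring_scope.

Lemma fibSS (n : nat) : fib n.+2 = (fib n.+1 + fib n)%N.
Proof. by []. Qed.

Lemma fib_gt0 (n : nat) : (0 < fib n.+1)%N.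
Proof. by elim: n => // n IHn; rewrite fibSS addn_gt0 IHn. Qed.

(** Induction on [k] for all [m]: one unit moves from [k] to [m], and the Fibonacci recurrence
    regroups the products. The order [fib k * fib m] makes [qintM] later produce the base
    [q ^+ fib k]. *)
Lemma fib_addS (m k : nat) :
  fib (m.+1 + k) = (fib m.+1 * fib k.+1 + fib k * fib m)%N.
Proof.
elim: k m => [|k IHk] m; first by rewrite addn0 muln1 addn0.
by rewrite addnS -addSn IHk !fibSS; lia.
Qed.

Lemma qint0 (x : qfield) : qint x 0 = 0.
Proof. by rewrite /qint big_geq. Qed.

Lemma qintS (x : qfield) (a : nat) : qint x a.+1 = qint x a + x ^+ a.
Proof. by rewrite /qint big_nat_recr. Qed.

Lemma qintD (x : qfield) (a b : nat) :
  qint x (a + b) = qint x a + x ^+ a * qint x b.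
Proof.
elim: b => [|b IHb]; first by rewrite addn0 qint0 mulr0 addr0.
by rewrite addnS !qintS IHb mulrDr exprD addrA.
Qed.

Lemma qintM (x : qfield) (a b : nat) :
  qint x (a * b) = qint x a * qint (x ^+ a) b.
Proof.
elim: b => [|b IHb]; first by rewrite muln0 !qint0 mulr0.
by rewrite mulnSr qintD IHb qintS mulrDr -exprM [x ^+ _ * _]mulrC.
Qed.

(** The element comes from a polynomial whose value at 1 is the nonzero integer [m]. *)
Lemma qint_q_neq0 (m : nat) : (0 < m)%N -> qint q m != 0.
Proof.
move=> m_gt0.
have -> : qint q m = tofrac (\sum_(0 <= i < m) 'X^i).
  by rewrite /qint rmorph_sum; apply: eq_bigr => i _; rewrite rmorphXn.
rewrite tofrac_eq0; apply/eqP => /(congr1 (horner^~ 1)).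
rewrite horner_sum horner0.
under eq_bigr do rewrite hornerXn expr1n.
rewrite sumr_const_nat subn0; lia.
Qed.

Lemma qfib_factS (m : nat) : qfib_fact m.+1 = qfib_fact m * qint q (fib m.+1).
Proof. by rewrite /qfib_fact big_nat_recr. Qed.

Lemma qfib_fact_neq0 (m : nat) : qfib_fact m != 0.
Proof.
elim: m => [|m IHm]; first by rewrite /qfib_fact big_geq // oner_neq0.
rewrite qfib_factS; exact: mulf_neq0 IHm (qint_q_neq0 _ (fib_gt0 m)).
Qed.

Lemma qfibonomial0 (n : nat) : qfibonomial n 0 = 1.
Proof.
rewrite /qfibonomial subn0 {2}/qfib_fact big_geq // mul1r divff //.
exact: qfib_fact_neq0.
Qed.

(** Algebraic core of the Pascal rule: [a], [b] stand for the factorials at [k] and [m], and [c],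
    [d] for the last factors of those at [k.+1] and [m.+1]. *)
Lemma fraction_split (F : fieldType) (N a b c d x y z : F) :
    a != 0 -> b != 0 -> c != 0 -> d != 0 ->
  N * (d * x + z * (c * y)) / (a * c * (b * d)) =
    x * (N / (a * c * b)) + z * y * (N / (a * (b * d))).
Proof. by move=> a0 b0 c0 d0; field; rewrite a0 b0 c0 d0. Qed.

Lemma qfibonomial_rec (m k : nat) :
  qfibonomial (m.+1 + k.+1) k.+1 =
    qint (q ^+ fib m.+1) (fib k.+2) * qfibonomial (m + k.+1) k.+1
    + q ^+ (fib m.+1 * fib k.+2) * qint (q ^+ fib k.+1) (fib m)
      * qfibonomial (m.+1 + k) k.
Proof.
rewrite /qfibonomial !addnK addSn qfib_factS -addSn fib_addS qintD !qintM.
(* Both smaller coefficients then share the numerator [qfib_fact (m.+1 + k)]. *)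
rewrite -addSnnS !qfib_factS.
apply: fraction_split.
- exact: qfib_fact_neq0.
- exact: qfib_fact_neq0.
- exact: qint_q_neq0 _ (fib_gt0 k).
- exact: qint_q_neq0 _ (fib_gt0 m).
Qed.

(** With [n = m.+1 + k], the number [m = n - k - 1] stays fixed during the induction on [k]. *)
Lemma qfibonomial_sum (m k : nat) :
  qfibonomial (m.+1 + k) k =
  \sum_(0 <= i < k.+1)
    (q ^+ (fib m.+1 * \sum_(1 <= j < i.+1) fib (k - j + 2))%N
     * (\prod_(1 <= j < i.+1) qint (q ^+ fib (k - j + 1)) (fib m))
     * qint (q ^+ fib m.+1) (fib (k - i + 1))
     * qfibonomial (m + k - i) (k - i)).
Proof.
elim: k => [|k IHk].
  by rewrite big_nat1 !big_geq // muln0 !qfibonomial0 /qint big_nat1 !mulr1.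
(* The first term of the rule is the summand [i = 0]. *)
rewrite qfibonomial_rec IHk [in RHS]big_nat_recl //; congr (_ + _).
  by rewrite !big_geq // muln0 !mul1r !subn0 addn1.
rewrite mulr_sumr; apply: eq_bigr => i _.
(* Summand [i] for [k] becomes summand [i.+1] for [k.+1]: the [j = 1] entries of the inner sum and
   product supply the prefactor of the rule. *)
rewrite [in RHS]big_nat_recl // [in X in _ = _ * X * _ * _]big_nat_recl //.
rewrite [(m + k.+1)%N]addnS !subSS subn0 [(k + 2)%N]addn2 [(k + 1)%N]addn1.
under [in RHS]eq_bigr do rewrite subSS.
under [X in _ = _ * (_ * X) * _ * _]eq_bigr do rewrite subSS.
rewrite mulnDr exprD [LHS]mulrA; congr (_ * _).
rewrite [LHS]mulrA; congr (_ * _); exact: mulrACA.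
Qed.

Theorem proposition3p4 (n k : nat) (hn : (1 <= n)%N) (hk : (k <= n - 1)%N) :
  qfibonomial n k =
  \sum_(0 <= i < k.+1)
    (q ^+ (fib (n - k) * \sum_(1 <= j < i.+1) fib (k - j + 2))%N
     * (\prod_(1 <= j < i.+1) qint (q ^+ fib (k - j + 1)) (fib (n - k - 1)))
     * qint (q ^+ fib (n - k)) (fib (k - i + 1))
     * qfibonomial (n - i - 1) (k - i)).
Proof.
have [m ->] : exists m, n = (m.+1 + k)%N by exists (n - k - 1)%N; lia.
rewrite addnK subn1 /= qfibonomial_sum.
by apply: eq_bigr => i _; rewrite subnAC addSn subn1.
Qed.
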